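(* Let $\mathcal D$ be the set of all persistence diagrams (with finite support), endowed with the bottleneck metric. Then $\mathrm{asdim}\,\mathcal D=\infty$; that is, there is no integer $n\ge 0$ such that the asymptotic dimension of $\mathcal D$ does not exceed $n$.
   Context: Let $\mathbb R^2_+=[0,\infty)^2$, $\Delta=\{(x,y)\in\mathbb R^2_+\mid x=y\}$, $\hat X=\{(x,y)\in\mathbb R^2_+\mid x\le y\}$. Persistence diagrams. A persistence diagram is a function $\mu\colon\hat X\to\mathbb Z_+=\{0,1,2,\dots\}$ such that $\mu(a)=0$ for all but finitely many $a\in\hat X$ and $\mu(a)=0$ for all $a\in\Delta$. Its support is $\mathrm{supp}(\mu)=\{a\in\hat X\mid\mu(a)>0\}$. The set of all persistence diagrams is denoted by $\mathcal D$. Bottleneck metric. A sequential representation of $\mu\in\mathcal D$ of length $k$ is a finite sequence $(a_1,\dots,a_k)$ of points of $\hat X$ such that (1) for every $a\in\mathrm{supp}(\mu)$, $|\{i\le k\mid a_i=a\}|=\mu(a)$; (2) if $a_i\notin\mathrm{supp}(\mu)$, then $a_i\in\Delta$. Let $\rho$ be the metric $\rho((x,y),(x',y'))=\max\{|x-x'|,|y-y'|\}$ on $\mathbb R^2$ and $S_k$ the group of permutations of $\{1,\dots,k\}$. For $\mu,\nu\in\mathcal D$ the bottleneck distance $d(\mu,\nu)$ is the infimum, over all $k\in\mathbb N$ and all pairs of sequential representations $(a_1,\dots,a_k)$ of $\mu$ and $(b_1,\dots,b_k)$ of $\nu$ of the same length $k$, of $$\min_{\sigma\in S_k}\ \max_{1\le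 i\le k}\rho(a_i,b_{\sigma(i)}).$$ The function $d$ is a metric on $\mathcal D$. Asymptotic dimension (Gromov). Let $Y$ be a metric space. A family $\mathcal A$ of subsets of $Y$ is uniformly bounded if $\sup\{\mathrm{diam}(A)\mid A\in\mathcal A\}<\infty$. For $D>0$, a family $\mathcal A$ is $D$-disjoint if $\mathrm{dist}(A,B)=\inf\{d(a,b)\mid a\in A,\ b\in B\}\ge D$ for all distinct $A,B\in\mathcal A$. The asymptotic dimension of $Y$ does not exceed $n$ (written $\mathrm{asdim}\,Y\le n$) if for every $D>0$ there is a uniformly bounded cover $\mathcal U$ of $Y$ with $\mathcal U=\bigcup_{i=0}^n\mathcal U_i$, where each family $\mathcal U_i$ is $D$-disjoint. *)

(* Defs.v *)
From HB Require Import structures.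
From mathcomp Require Import all_boot all_order all_algebra all_fingroup.
From mathcomp Require Import lra.
From mathcomp Require Import boolp classical_sets functions cardinality.
From mathcomp Require Import reals ereal topology.

Set Implicit Arguments.
Unset Strict Implicit.
Unset Printing Implicit Defensive.

Import Order.TTheory GRing.Theory Num.Theory.

Local Open Scope classical_set_scope.
Local Open Scope ring_scope.

Definition hatX (R : realType) : Type := {p : R * R | 0 <= p.1 <= p.2}.

Definition diagonal (R : realType) (a : hatX R) : bool :=
  (val a).1 == (val a).2.

Definition rho (R : realType) (a b : hatX R) : R :=
  Num.max `|(val a).1 - (val b).1| `|(val a).2 - (val b).2|.

Record diagram (R : realType) := Diagram {
  mult :> hatX R -> nat;
  mult_finite : finite_set [set a | mult a != 0%N];
  mult_diagonal : forall a, diagonal a -> mult a = 0%N }.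

Definition supp (R : realType) (mu : diagram R) : set (hatX R) :=
  [set a | (0 < mu a)%N].

Definition seq_repr (R : realType) (mu : diagram R) (k : nat)
    (a : k.-tuple (hatX R)) : Prop :=
  (forall x, supp mu x -> #|[pred i | tnth a i == x]| = mu x) /\
  (forall i, ~ supp mu (tnth a i) -> diagonal (tnth a i)).

(* The maximum over the empty index set, which only occurs when k = 0, is 0. *)
Definition perm_cost (R : realType) (k : nat) (a b : k.-tuple (hatX R))
    (s : 'S_k) : R :=
  \big[Num.max/0]_(i < k) rho (tnth a i) (tnth b (s i)).

(* The default value is itself one of the terms, so this is their minimum. *)
Definition matching_cost (R : realType) (k : nat) (a b : k.-tuple (hatX R)) : R :=
  \big[Num.min/perm_cost a b 1%g]_(s : 'S_k) perm_cost a b s.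

Definition bottleneck (R : realType) (mu nu : diagram R) : R :=
  inf [set c | exists k : nat, exists a b : k.-tuple (hatX R),
         [/\ seq_repr mu a, seq_repr nu b & c = matching_cost a b]].

(* [represents mu s] is [seq_repr] on plain lists, and [close_by mu nu e] says
   that some matching of representations has cost < e, given as the list of
   matched pairs. For the triangle inequality, two such lists are padded with
   diagonal pairs (x, x) until their middle components are permutations of each
   other. *)
Section BottleneckMetric.
Variable R : realType.
Implicit Types (mu nu la : diagram R) (s t : seq (hatX R)) (a b x y z : hatX R).

Let represents mu s := forall x, ~~ diagonal x -> count_mem x s = mu x.

Let close_by mu nu (e : R) := exists w : seq (hatX R * hatX R),
  [/\ represents mu (unzip1 w), represents nu (unzip2 w) &
      forall p, p \in w -> rho p.1 p.2 < e].

Let rhoxx x : rho x x = 0.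
Proof. by rewrite /rho !subrr normr0 maxxx. Qed.

Let rhoC x y : rho x y = rho y x.
Proof. by rewrite /rho distrC [X in Num.max _ X]distrC. Qed.

Let rho_tri x y z : rho x z <= rho x y + rho y z.
Proof.
rewrite /rho ge_max; apply/andP; split.
  apply: (le_trans (ler_distD (val y).1 _ _)).
  by apply: lerD; rewrite le_max lexx.
apply: (le_trans (ler_distD (val y).2 _ _)).
by apply: lerD; rewrite le_max lexx orbT.
Qed.

Let rho_ge0 x y : 0 <= rho x y.
Proof. by rewrite /rho le_max normr_ge0. Qed.

Let rho_eq0 x y : rho x y = 0 -> x = y.
Proof.
move=> h; have : rho x y <= 0 by rewrite h.
rewrite /rho ge_max !normr_le0 !subr_eq0 => /andP[/eqP h1 /eqP h2].
by apply: val_inj; move: h1 h2; case: (val x) (val y) => [? ?] [? ?] /= -> ->.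
Qed.

Let mult_gt0_ndiag mu x : supp mu x -> ~~ diagonal x.
Proof. by rewrite /supp/= => h; apply/negP => /(mult_diagonal mu) E; rewrite E in h. Qed.

Let card_count k (a : k.-tuple (hatX R)) x :
  #|[pred i | tnth a i == x]| = count_mem x a.
Proof.
rewrite -[in RHS](map_tnth_enum a) count_map cardE size_filter.
by rewrite enumT; apply: eq_count => i.
Qed.

Let seq_reprP mu k (a : k.-tuple (hatX R)) : seq_repr mu a <-> represents mu a.
Proof.
split=> [[h1 h2] x dx|h].
  have [sx|sx] := pselect (supp mu x); first by rewrite -h1// card_count.
  have -> : (mu x = 0)%N by apply/eqP; rewrite -leqn0 leqNgt; apply/negP.
  apply/count_memPn/negP => /tnthP[i xi]; move: dx; rewrite xi h2//.
  by rewrite -xi.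
split=> [x sx|i si]; first by rewrite card_count h// (mult_gt0_ndiag sx).
apply: contrapT => /negP di; apply: si; rewrite /supp/= -h//.
by rewrite -has_count has_pred1 mem_tnth.
Qed.

Let repr_ex mu : exists s, represents mu s.
Proof.
have [s sE] := (finite_seqP _).1 (mult_finite mu).
exists (flatten [seq nseq (mu x) x | x <- undup s]) => x _.
rewrite count_flatten -map_comp sumnE big_map.
rewrite (eq_bigr (fun i => if i == x then mu x else 0%N)); last first.
  move=> i _ /=; rewrite count_nseq /= eq_sym.
  by case: eqVneq => [->|]; rewrite (mul1n, mul0n).
rewrite -big_mkcond/=.
have [xs|xs] := boolP (x \in s).
  rewrite (big_rem x) ?mem_undup//= eqxx big_seq_cond big1 ?addn0// => i.
  by rewrite mem_rem_uniq ?undup_uniq// inE => /andP[/andP[/negbTE->]].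
rewrite big_seq_cond big1.
  have : ~ [set` s] x by exact/negP.
  by rewrite -sE /= => /negP; rewrite negbK => /eqP.
by move=> i /andP[]; rewrite mem_undup => + /eqP ix; rewrite ix (negbTE xs).
Qed.

Let close_refl mu e : 0 < e -> close_by mu mu e.
Proof.
move=> e0; have [s hs] := repr_ex mu; exists [seq (x, x) | x <- s].
rewrite /unzip1 /unzip2 -!map_comp !map_id; split=> // p /mapP[x _ ->] /=.
by rewrite rhoxx.
Qed.

Let close_sym mu nu e : close_by mu nu e -> close_by nu mu e.
Proof.
move=> [w [h1 h2 h3]]; exists [seq (p.2, p.1) | p <- w].
rewrite /unzip1 /unzip2 -!map_comp; split=> // p /mapP[x xw ->] /=.
by rewrite rhoC h3.
Qed.

Let represents_cat mu s t : represents mu s -> all (@diagonal R) t ->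
  represents mu (s ++ t).
Proof.
move=> hs /allP ht x dx; rewrite count_cat hs// (count_memPn _) ?addn0//.
by apply: contra dx => /ht.
Qed.

Let unzip1_diag t : unzip1 [seq (x, x) | x <- t] = t.
Proof. by rewrite /unzip1 -map_comp map_id. Qed.
Let unzip2_diag t : unzip2 [seq (x, x) | x <- t] = t.
Proof. by rewrite /unzip2 -map_comp map_id. Qed.

Let close_diag (w : seq (hatX R * hatX R)) t (e : R) : 0 < e ->
  (forall p, p \in w -> rho p.1 p.2 < e) ->
  forall p, p \in w ++ [seq (x, x) | x <- t] -> rho p.1 p.2 < e.
Proof.
move=> e0 h p; rewrite mem_cat => /orP[/h//|/mapP[x _ ->]] /=.
by rewrite rhoxx.
Qed.

Let close_trans nu mu la e f : 0 < e -> 0 < f ->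
  close_by mu nu e -> close_by nu la f -> close_by mu la (e + f).
Proof.
move=> e0 f0 [w0 [w1 w2 w3]] [v0 [v1 v2 v3]].
pose dw := [seq x <- unzip2 w0 | diagonal x].
pose dv := [seq x <- unzip1 v0 | diagonal x].
have adw : all (@diagonal R) dw by exact: filter_all.
have adv : all (@diagonal R) dv by exact: filter_all.
pose w := w0 ++ [seq (x, x) | x <- dv].
pose v := v0 ++ [seq (x, x) | x <- dw].
have hw := close_diag (t := dv) e0 w3; have hv := close_diag (t := dw) f0 v3.
have uw1 : represents mu (unzip1 w).
  by rewrite /unzip1 map_cat -/(unzip1 _) -/(unzip1 _) unzip1_diag; exact: represents_cat.
have uv2 : represents la (unzip2 v).
  by rewrite /unzip2 map_cat -/(unzip2 _) -/(unzip2 _) unzip2_diag; exact: represents_cat.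
have E : perm_eq (unzip2 w) (unzip1 v).
  rewrite /unzip1 /unzip2 !map_cat -/(unzip2 _) -/(unzip1 _).
  rewrite -/(unzip2 [seq (x, x) | x <- dv]) -/(unzip1 [seq (x, x) | x <- dw]).
  rewrite unzip1_diag unzip2_diag; apply/allP => x _ /=; apply/eqP.
  rewrite !count_cat !count_filter; have [dx|dx] := boolP (diagonal x).
    rewrite addnC; congr (_ + _)%N; apply: eq_count => y /=;
    by case: eqVneq => //= ->; rewrite dx.
  rewrite w2// v1//; congr (_ + _)%N.
  rewrite !(@eq_count _ (predI _ _) pred0) ?count_pred0// => y /=;
  by case: eqVneq => //= ->; rewrite (negbTE dx).
case sw : w => [|p0 w'].
  move: E; rewrite sw /= perm_sym => /perm_nilP; case: (v) uv2 => // uv2 _.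
  by exists [::]; split => //; move: uw1; rewrite sw.
have /(perm_iotaP p0.1)[Is pI eI] := E.
have sz : size Is = size w by move/(congr1 size): eI; rewrite !size_map.
have sIv : size Is = size v by rewrite (perm_size pI) size_iota size_map.
have lI i : (i < size w)%N -> (nth 0%N Is i < size v)%N.
  move=> iw; have : nth 0%N Is i \in Is by rewrite mem_nth// sz.
  by rewrite (perm_mem pI) mem_iota /= add0n size_map.
pose f1 i := (nth p0 w i).1; pose f2 i := (nth p0 v (nth 0%N Is i)).2.
exists (mkseq (fun i => (f1 i, f2 i)) (size w)); split.
- rewrite /unzip1 -map_comp.
  have -> : [seq (fst \o (fun i => (f1 i, f2 i))) i | i <- iota 0 (size w)] = unzip1 w.
    by rewrite -[in RHS](mkseq_nth p0 w) /unzip1 -map_comp.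
  exact: uw1.
- rewrite /unzip2 -map_comp => x dx; rewrite -uv2//; apply/seq.permP.
  rewrite perm_sym -[in X in perm_eq X _](mkseq_nth p0 v) /unzip2 -map_comp.
  have -> : [seq (snd \o (fun i => (f1 i, f2 i))) i | i <- iota 0 (size w)]
          = [seq (nth p0 v j).2 | j <- Is].
    by rewrite -[in RHS](mkseq_nth 0%N Is) -map_comp sz.
  apply: (perm_map (fun j => (nth p0 v j).2)).
  by rewrite perm_sym; move: pI; rewrite size_map.
- move=> p /mapP[i]; rewrite mem_iota add0n => /andP[_ iw] -> /=.
  have h1 := hw _ (mem_nth p0 iw); have h2 := hv _ (mem_nth p0 (lI _ iw)).
  apply: le_lt_trans (ltrD h1 h2).
  suff -> : (nth p0 w i).2 = (nth p0 v (nth 0%N Is i)).1 by exact: rho_tri.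
  have := congr1 (fun s => nth p0.1 s i) eI.
  rewrite (nth_map p0)// (nth_map 0%N) ?sz// => ->.
  by rewrite (nth_map p0)// lI.
Qed.

Let sep_seq x s : exists2 e : R, 0 < e &
  forall y, y \in s -> y != x -> e <= rho x y.
Proof.
elim: s => [|y s [e e0 IH]]; first by exists 1.
have [->|xy] := eqVneq y x.
  by exists e => // z; rewrite inE => /orP[/eqP->|/IH//]; rewrite eqxx.
exists (Num.min e (rho x y)).
  rewrite lt_min e0 lt_neqAle rho_ge0 andbT.
  by apply: contra_neq xy => /esym/rho_eq0.
move=> z; rewrite inE => /orP[/eqP-> _|zs zx].
  by rewrite ge_min lexx orbT.
by rewrite ge_min IH.
Qed.

Let sep_diagonal x : ~~ diagonal x -> exists2 e : R, 0 < e &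
  forall y, diagonal y -> e <= rho x y.
Proof.
move=> dx; exists (((val x).2 - (val x).1) / 2).
  have /andP[_ +] := valP x; move: dx; rewrite /diagonal; set p := (val x) => dp pp.
  by rewrite divr_gt0// subr_gt0 lt_neqAle dp.
move=> y /eqP dy; rewrite /rho dy; set p := val x; set q := (val y).2.
rewrite leNgt; apply/negP; rewrite gt_max !ltr_norml => /andP[/andP[h1 h2] /andP[h3 h4]].
lra.
Qed.

Let sep_diagram mu x : ~~ diagonal x -> exists2 e : R, 0 < e &
  forall y, diagonal y \/ supp mu y -> y != x -> e <= rho x y.
Proof.
move=> dx; have [e e0 he] := sep_diagonal dx.
have [s hs] := repr_ex mu; have [f f0 hf] := sep_seq x s.
exists (Num.min e f); first by rewrite lt_min e0.
move=> y [dy _|sy yx]; first by rewrite ge_min he.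
rewrite ge_min hf ?orbT//.
by rewrite -has_pred1 has_count hs// (mult_gt0_ndiag sy).
Qed.

Let close_eq mu nu : (forall e, 0 < e -> close_by mu nu e) -> mu = nu.
Proof.
move=> h; suff E : mult mu = mult nu.
  by move: mu nu E {h} => [m ? ?] [n ? ?] /= E; subst; congr Diagram; exact: Prop_irrelevance.
apply/funext => x; have [dx|dx] := boolP (diagonal x); first by rewrite !mult_diagonal.
have [e e0 he] := sep_diagram mu dx; have [f f0 hf] := sep_diagram nu dx.
have /h[w [w1 w2 w3]] : 0 < Num.min e f by rewrite lt_min e0.
rewrite -w1// -w2// /unzip1 /unzip2 !count_map; apply: eq_in_count => p pw /=.
have := w3 p pw; rewrite lt_min => /andP[pe pf].
have mem la s : represents la s -> forall y, y \in s -> diagonal y \/ supp la y.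
  move=> hs y ys; have [|dy] := boolP (diagonal y); [by left|].
  by right; rewrite /supp/= -hs// -has_count has_pred1.
apply/eqP/eqP => px; apply/eqP; apply: contraT => px'.
  have := hf _ (mem _ _ w2 _ (map_f snd pw)) px'.
  by rewrite -px leNgt pf.
have := he _ (mem _ _ w1 _ (map_f fst pw)) px'.
by rewrite -px rhoC leNgt pe.
Qed.

Let costs mu nu := [set c | exists k : nat, exists a b : k.-tuple (hatX R),
         [/\ seq_repr mu a, seq_repr nu b & c = matching_cost a b]].

Let perm_cost_ge0 k (a b : k.-tuple (hatX R)) (s : 'S_k) : 0 <= perm_cost a b s.
Proof.
rewrite /perm_cost; elim/big_ind: _ => // x y x0 y0.
by rewrite le_max x0.
Qed.

Let matching_cost_ge0 k (a b : k.-tuple (hatX R)) : 0 <= matching_cost a b.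
Proof.
rewrite /matching_cost; elim/big_ind: _ => [|x y x0 y0|s _] //.
by rewrite le_min x0.
Qed.

Let costs_lb mu nu : lbound (costs mu nu) 0.
Proof. by move=> c [k [a [b [_ _ ->]]]]; exact: matching_cost_ge0. Qed.

Let perm_cost_lt k (a b : k.-tuple (hatX R)) (s : 'S_k) (e : R) : 0 < e ->
  perm_cost a b s < e <-> forall i, rho (tnth a i) (tnth b (s i)) < e.
Proof.
move=> e0; split=> [h i|h].
  apply: le_lt_trans h; rewrite /perm_cost (bigD1 i)//=.
  by rewrite le_max lexx.
rewrite /perm_cost; elim/big_ind: _ => // x y xe ye.
by rewrite gt_max xe.
Qed.

Let matching_cost_lt k (a b : k.-tuple (hatX R)) (e : R) :
  matching_cost a b < e <-> exists s : 'S_k, perm_cost a b s < e.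
Proof.
split=> [|[s hs]].
  rewrite /matching_cost; elim/big_ind: _ => [h|x y hx hy|s _ hs].
  - by exists 1%g.
  - by rewrite gt_min => /orP[].
  - by exists s.
apply: le_lt_trans hs; rewrite /matching_cost (bigD1 s)//=.
by rewrite ge_min lexx.
Qed.

Let close_costP mu nu e : 0 < e ->
  close_by mu nu e <-> exists2 c, costs mu nu c & c < e.
Proof.
move=> e0; split=> [[w [w1 w2 w3]]|[_ [k [a [b [ra rb ->]]]]]].
  pose a := [tuple of map fst (in_tuple w)].
  pose b := [tuple of map snd (in_tuple w)].
  exists (matching_cost a b).
    by exists (size w), a, b; split=> //; apply/seq_reprP.
  apply/matching_cost_lt; exists 1%g; apply/(perm_cost_lt _ _ _ e0) => i.
  by rewrite perm1 !tnth_map w3// mem_tnth.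
move=> /matching_cost_lt[s /(perm_cost_lt _ _ _ e0) hs].
exists [seq (tnth a i, tnth b (s i)) | i <- enum 'I_k]; split.
- rewrite /unzip1 -map_comp; have -> : [seq (fst \o (fun i => (tnth a i, tnth b (s i)))) i | i <- enum 'I_k] = a :> seq _.
    by rewrite -[in RHS](map_tnth_enum a).
  exact/seq_reprP.
- move=> x dx; move/seq_reprP : rb => <-//; apply/seq.permP.
  rewrite /unzip2 -map_comp -[in X in perm_eq _ X](map_tnth_enum b).
  have -> : [seq (snd \o (fun i => (tnth a i, tnth b (s i)))) i | i <- enum 'I_k]
    = [seq tnth b j | j <- [seq s i | i <- enum 'I_k]].
    by rewrite -[RHS]map_comp; apply: eq_map.
  apply: perm_map; apply: uniq_perm; [|exact: enum_uniq|].
    by rewrite (map_inj_uniq (@perm_inj _ s)) enum_uniq.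
  move=> j; rewrite mem_enum; apply/mapP; exists ((s^-1)%g j); rewrite ?mem_enum//.
  by rewrite permKV.
- by move=> p /mapP[i _ ->] /=.
Qed.

Let close_add mu nu (e f : R) : e <= f -> close_by mu nu e -> close_by mu nu f.
Proof.
by move=> ef [w [w1 w2 w3]]; exists w; split=> // p /w3 h; exact: lt_le_trans ef.
Qed.

Let close_ex mu nu : exists2 e, 0 < e & close_by mu nu e.
Proof.
have [s hs] := repr_ex mu; have [t ht] := repr_ex nu.
have pd (x : hatX R) : 0 <= ((val x).1, (val x).1).1 <= ((val x).1, (val x).1).2.
  by have /andP[h _] := valP x; rewrite h lexx.
pose pr x : hatX R := exist _ ((val x).1, (val x).1) (pd x).
have dpr u : all (@diagonal R) (map pr u).
  by apply/allP => _ /mapP[x _ ->]; rewrite /diagonal /=.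
pose w := [seq (x, pr x) | x <- s] ++ [seq (pr y, y) | y <- t].
have bnd (v : seq (hatX R * hatX R)) : exists2 e, 0 < e & forall p, p \in v -> rho p.1 p.2 < e.
  elim: v => [|p v [e e0 IH]]; first by exists 1.
  exists (e + rho p.1 p.2 + 1); first by have := rho_ge0 p.1 p.2; lra.
  move=> q; rewrite inE => /orP[/eqP->|/IH]; first by lra.
  by have := rho_ge0 p.1 p.2; lra.
have [e e0 he] := bnd w; exists e => //; exists w; split=> //.
- rewrite /unzip1 map_cat -!map_comp -/(represents _ _) (eq_map (g := id)) // map_id.
  exact: represents_cat.
- rewrite /unzip2 map_cat -!map_comp [X in _ ++ X](eq_map (g := id)) // map_id.
  move=> x dx; rewrite count_cat addnC -count_cat; exact: represents_cat.
Qed.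

Let costs_ne mu nu : costs mu nu !=set0.
Proof. by have [e e0 /(close_costP _ _ e0)[c hc _]] := close_ex mu nu; exists c. Qed.

Let bottleneck_lt mu nu e : 0 < e -> bottleneck mu nu < e <-> close_by mu nu e.
Proof.
move=> e0; split=> [h|/(close_costP _ _ e0)[c hc ce]].
  apply/(close_costP _ _ e0).
  have h0 : 0 < e - bottleneck mu nu by rewrite subr_gt0.
  have [|c hc] := @inf_adherent _ (costs mu nu) _ h0.
    by split; [exact: costs_ne | exists 0; exact: costs_lb].
  by rewrite -/(costs _ _) -/(bottleneck mu nu) addrC subrK => ce; exists c.
by apply: le_lt_trans ce; apply: ge_inf => //; exists 0; exact: costs_lb.
Qed.

Let bottleneck_ge0 mu nu : 0 <= bottleneck mu nu.
Proof. by apply: lb_le_inf; [exact: costs_ne | exact: costs_lb]. Qed.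

Lemma bottleneckxx mu : bottleneck mu mu = 0.
Proof.
apply/eqP; rewrite eq_le bottleneck_ge0 andbT; apply/ler_addgt0Pr => e e0.
by rewrite add0r; apply/ltW/(bottleneck_lt _ _ e0)/close_refl.
Qed.

Lemma bottleneck_positivity mu nu : bottleneck mu nu = 0 -> mu = nu.
Proof.
by move=> h; apply: close_eq => e e0; apply/(bottleneck_lt _ _ e0); rewrite h.
Qed.

Lemma bottleneckC mu nu : bottleneck mu nu = bottleneck nu mu.
Proof.
have h (m n : diagram R) : bottleneck m n <= bottleneck n m; last first.
  by apply/eqP; rewrite eq_le !h.
apply/ler_addgt0Pr => e e0; have he : 0 < bottleneck n m + e by rewrite ltr_pwDr ?bottleneck_ge0.
apply/ltW/(bottleneck_lt _ _ he)/close_sym/(bottleneck_lt _ _ he).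
by rewrite ltrDl.
Qed.

Lemma bottleneck_triangle nu mu la :
  bottleneck mu la <= bottleneck mu nu + bottleneck nu la.
Proof.
apply/ler_addgt0Pr => e e0.
have d0 : 0 < e / 2 by rewrite divr_gt0.
have p1 : 0 < bottleneck mu nu + e / 2 by rewrite ltr_pwDr ?bottleneck_ge0.
have p2 : 0 < bottleneck nu la + e / 2 by rewrite ltr_pwDr ?bottleneck_ge0.
have -> : bottleneck mu nu + bottleneck nu la + e =
  (bottleneck mu nu + e / 2) + (bottleneck nu la + e / 2) by lra.
apply/ltW/bottleneck_lt; first exact: addr_gt0.
by apply: (close_trans (nu := nu)) => //; apply/bottleneck_lt => //; rewrite ltrDl.
Qed.

End BottleneckMetric.

HB.instance Definition _ (R : realType) := gen_eqMixin (diagram R).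
HB.instance Definition _ (R : realType) := gen_choiceMixin (diagram R).
HB.instance Definition _ (R : realType) :=
  isMetric.Build R (diagram R) (@bottleneckxx R) (@bottleneck_positivity R)
    (@bottleneckC R) (@bottleneck_triangle R).

Lemma mdist_bottleneck (R : realType) (mu nu : diagram R) :
  mdist mu nu = bottleneck mu nu.
Proof. by []. Qed.

(* Conventions for the empty set: [diam set0 = -oo] and
   [set_dist set0 B = set_dist A set0 = +oo], so empty members of a family
   affect neither uniform boundedness nor D-disjointness. *)
Section AsymptoticDimension.
Variables (R : realType) (Y : metricType R).

Definition diam (A : set Y) : \bar R :=
  ereal_sup [set (mdist p.1 p.2)%:E | p in A `*` A].

Definition set_dist (A B : set Y) : \bar R :=
  ereal_inf [set (mdist p.1 p.2)%:E | p in A `*` B].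

Definition uniformly_bounded (F : set (set Y)) : Prop :=
  (ereal_sup [set diam A | A in F] < +oo)%E.

Definition disjoint_by (D : R) (F : set (set Y)) : Prop :=
  forall A B, F A -> F B -> A <> B -> (D%:E <= set_dist A B)%E.

Definition asdim_le (n : nat) : Prop :=
  forall D : R, 0 < D ->
  exists (U : set (set Y)) (V : 'I_n.+1 -> set (set Y)),
    [/\ uniformly_bounded U, \bigcup_(A in U) A = setT,
        U = \bigcup_i V i & forall i, disjoint_by D (V i)].

End AsymptoticDimension.

Arguments asdim_le {R} Y n.

(* Main.v *)
(* Points of the grid [{0..N+1}^m] with the sup metric embed almost
   isometrically into the diagrams: a grid point x gives the diagram with the m
   points [(i K, i K + 2 K + x_i)], K = N + 1, which are so far from each other and
   from the diagonal that a matching of cost less than K must pair the i-th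
   points. With m = n + 1, a cover of the grid by n + 1 families, each
   2-disjoint, has a member meeting two opposite facets (Lebesgue's covering
   theorem), so its diameter is at least K, which is arbitrarily large.

   Lebesgue's theorem follows from Sperner's lemma for the cube: choose a member
   around each grid point and label the point by the number j such that the
   member meets the last facets [x_i = N + 1] for all [i < j] but not for
   [i = j]. Some small simplex carries all the m + 1 labels; by pigeonhole two of
   its vertices have members in the same family, hence the same member, hence
   the same label. *)

Require Import Defs.
From mathcomp Require Import all_boot all_order all_algebra reals topology.
From mathcomp Require Import all_fingroup lra boolp classical_sets cardinality ereal.

Set Implicit Arguments.
Unset Strict Implicit.
Unset Printing Implicit Defensive.

Import Order.TTheory GRing.Theory Num.Theory.

(** * Sperner's lemma for the cube *)

(** [f] pairs each element satisfying [p] with one that does not, and [F] agrees on the two, so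
    their contributions cancel modulo 2. *)
Lemma xor_involution (T : eqType) (X : seq T) (f : T -> T) (p F : pred T) :
  uniq X -> involutive f -> {in X, forall x, f x \in X} ->
  {in X, forall x, p (f x) = ~~ p x} -> {in X, forall x, F (f x) = F x} ->
  \big[addb/false]_(x <- X) F x = false.
Proof.
move=> uX fK fX pf Ff; rewrite (bigID p) /=.
suff -> : \big[addb/false]_(x <- X | ~~ p x) F x =
          \big[addb/false]_(x <- X | p x) F x by rewrite addbb.
have fX' : perm_eq X (map f X).
  apply: uniq_perm; rewrite ?(map_inj_uniq (inv_inj fK))// => x.
  apply/idP/mapP => [xX|[y yX ->]]; last exact: fX.
  by exists (f x); rewrite ?fX ?fK.
rewrite (perm_big _ fX') big_map big_seq_cond [RHS]big_seq_cond.
apply: eq_big => x; last by case/andP=> /Ff.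
by case: (boolP (x \in X)) => //= /pf ->; rewrite negbK.
Qed.

Lemma perm_cons2r (T : eqType) (x y : T) (s : seq T) :
  perm_eq (x :: s) (y :: s) = (x == y).
Proof.
rewrite (perm_cat2r s [:: x] [:: y]); apply/idP/eqP => [/perm_mem/(_ x)|->//].
by rewrite !inE eqxx => /esym/eqP.
Qed.

Lemma perm_cons_iota (x k : nat) : perm_eq (x :: iota 0 k) (iota 0 k.+1) = (x == k).
Proof.
by rewrite -addn1 iotaD /= add0n cats1 perm_sym perm_rcons perm_cons2r eq_sym.
Qed.

(* In a door at x, removing x leaves the labels 0..k-1. If x < k then x occurs
   twice, so it contributes two doors, and only x = k counts modulo 2. *)
Lemma xor_doors (l : seq nat) (k : nat) : {in l, forall x, x <= k} ->
  \big[addb/false]_(x <- l) perm_eq l (x :: iota 0 k) = perm_eq l (iota 0 k.+1).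
Proof.
move=> lk.
have [/hasP[x xl lx]|/hasPn nl] :=
  boolP (has (fun x => perm_eq l (x :: iota 0 k)) l).
  rewrite (perm_big _ lx) /= (permPl lx) perm_cons_iota.
  rewrite (eq_bigr (fun y => y == x)) => [|y _]; last first.
    by rewrite (permPl lx) perm_cons2r eq_sym.
  have -> (s : seq nat) : \big[addb/false]_(y <- s) (y == x) = odd (count_mem x s).
    by elim: s => [|y s IH]; rewrite ?big_nil// big_cons IH /= oddD oddb.
  rewrite /= eqxx count_uniq_mem ?iota_uniq// mem_iota /= add0n.
  by have := lk _ xl; rewrite leq_eqVlt; case: ltngtP.
rewrite big1_seq => [|x /andP[_ xl]]; last exact/negbTE/nl.
apply/esym/negP => lk1; have kl : k \in l.
  by rewrite (perm_mem lk1) mem_iota add0n leq0n ltnSn.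
by move/negP: (nl _ kl); rewrite (permPl lk1) perm_sym perm_cons_iota eqxx.
Qed.

(** Lists too short for the exchange stay unchanged, which makes this an involution on all lists. *)
Fixpoint swap_at (T : Type) (j : nat) (s : seq T) : seq T :=
  match j, s with
  | 0, a :: b :: s' => b :: a :: s'
  | j'.+1, a :: s' => a :: swap_at j' s'
  | _, _ => s
  end.

Lemma swap_atK (T : Type) (j : nat) : involutive (@swap_at T j).
Proof. by elim: j => [|j IH] [|a s] //=; [case: s|rewrite IH]. Qed.

Lemma perm_swap_at (T : eqType) (j : nat) (s : seq T) : perm_eq (swap_at j s) s.
Proof.
elim: j s => [|j IH] [|a s] //=; last by rewrite perm_cons.
by case: s => //= b s; rewrite (perm_catCA [:: b] [:: a] s).
Qed.

Lemma nth_swap_at (T : Type) (x0 : T) (j : nat) (s : seq T) : j.+1 < size s ->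
  nth x0 (swap_at j s) j = nth x0 s j.+1 /\ nth x0 (swap_at j s) j.+1 = nth x0 s j.
Proof. by elim: j s => [|j IH] [|a s] //=; [case: s|exact: IH]. Qed.

(** * Kuhn's triangulation of the grid *)

Section Sperner.
Variables (m N : nat).
Local Notation point := {ffun 'I_m -> 'I_N.+2}.
Implicit Types (x y z : point) (i : 'I_m) (s : seq 'I_m).

(* Coordinates live in Z/(N+2), so that [incr^~ i] is a bijection; wrapping around
   is excluded by requiring the coordinate to differ from -1, the largest one. *)
Definition incr z i : point := [ffun j => if j == i then (z j + 1)%R else z j].

(* When s enumerates a set of coordinates without repetition, these are the
   vertices of a simplex of Kuhn's triangulation. *)
Fixpoint walk z s : seq point :=
  z :: if s is i :: s' then walk (incr z i) s' else [::].

Lemma incrC z i j : incr (incr z i) j = incr (incr z j) i.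
Proof. by apply/ffunP => l; rewrite !ffunE; do 2!case: eqP. Qed.

Lemma size_walk z s : size (walk z s) = (size s).+1.
Proof. by elim: s z => //= i s IH z; rewrite IH. Qed.

Lemma walk_notin z s i x : i \notin s -> x \in walk z s -> x i = z i.
Proof.
elim: s z => [|j s IH] z /=; first by rewrite inE => _ /eqP->.
rewrite !inE negb_or => /andP[ij si] /orP[/eqP->//|/(IH _ si)->].
by rewrite ffunE (negbTE ij).
Qed.

Lemma walk_step z s i x : uniq s -> x \in walk z s -> x i = z i \/ x i = (z i + 1)%R.
Proof.
elim: s z => [|j s IH] z /=; first by rewrite inE => _ /eqP->; left.
move=> /andP[js us]; rewrite inE => /orP[/eqP->|xs]; first by left.
have [ij|ij] := eqVneq i j.
  by subst j; right; rewrite (walk_notin js xs) ffunE eqxx.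
by have := IH _ us xs; rewrite ffunE (negbTE ij).
Qed.

Lemma walk_rcons z s i : exists y, walk z (rcons s i) = rcons (walk z s) y.
Proof.
elim: s z => [|j s IH] z /=; first by exists (incr z i).
by have [y ->] := IH (incr z j); exists y.
Qed.

(** Increments commute, so exchanging steps [j] and [j.+1] changes only the vertex between them,
    which has index [j.+1]. *)
Lemma walk_swap_at z s j : j.+1 < size s -> exists l1 l2 x y,
  [/\ walk z s = l1 ++ x :: l2, walk z (swap_at j s) = l1 ++ y :: l2 & size l1 = j.+1].
Proof.
elim: j s z => [|j IH] [|a s] z //=.
  case: s => //= b s _; exists [:: z].
  rewrite (incrC z b a).
  by exists (walk (incr (incr z a) b) s), (incr z a), (incr z b).
move=> js; have [l1 [l2 [x [y [-> -> sl]]]]] := IH s (incr z a) js.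
by exists (z :: l1), l2, x, y; rewrite /= sl.
Qed.

(** * Sperner labellings and the parity of full simplices *)

Variable lam : point -> nat.
Hypothesis lam_max : forall x, lam x <= m.
Hypothesis lam0 : forall x i, x i = 0%R -> lam x <= i.
Hypothesis lamN : forall x i, x i = (-1)%R -> lam x != i.

Local Notation labels z s := (map lam (walk z s)).

(* The least vertices of the simplices of the face spanned by the first k
   coordinates. *)
Definition base (k : nat) : pred point :=
  fun z => [forall i : 'I_m, if i < k then z i != (-1)%R else z i == 0%R].

Definition coords (k : nat) : seq 'I_m := [seq i : 'I_m <- enum 'I_m | i < k].

Lemma mem_coords k i : (i \in coords k) = (i < k).
Proof. by rewrite mem_filter mem_enum andbT. Qed.

Lemma uniq_coords k : uniq (coords k).
Proof. by rewrite filter_uniq ?enum_uniq. Qed.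

Lemma size_coords k : k <= m -> size (coords k) = k.
Proof.
move=> km; rewrite -(size_map val) /coords.
rewrite -(filter_map val (fun j => j < k)) val_enum_ord.
rewrite (_ : [seq _ <- _ | _] = iota 0 k) ?size_iota//.
apply: (irr_sorted_eq ltn_trans ltnn); rewrite ?iota_ltn_sorted//.
  exact: sorted_filter ltn_trans _ _ (iota_ltn_sorted _ _).
by move=> i; rewrite mem_filter !mem_iota !add0n /= andb_idr// => /leq_trans->.
Qed.

Lemma coords_cons k i s : i :: s \in permutations (coords k) ->
  i < k /\ i \notin s.
Proof.
rewrite mem_permutations => sp; rewrite -mem_coords -(perm_mem sp) mem_head.
by have := perm_uniq sp; rewrite uniq_coords => /andP[].
Qed.

Definition full k z s := perm_eq (labels z s) (iota 0 k.+1).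

Definition parity k := \big[addb/false]_(z | base k z)
  \big[addb/false]_(s <- permutations (coords k)) full k z s.

(** The facet opposite to vertex [j] carries exactly the labels 0..k-1. *)
Definition door k j z s :=
  perm_eq (labels z s) (nth 0 (labels z s) j :: iota 0 k).

(** If [k < m], coordinate [k] vanishes on the face, so all labels are at most [k] and [xor_doors]
    applies. *)
Lemma full_doors k z s : k <= m -> base k z -> s \in permutations (coords k) ->
  full k z s = \big[addb/false]_(0 <= j < k.+1) door k j z s.
Proof.
move=> km /forallP bz; rewrite mem_permutations => ps; rewrite /full -xor_doors.
  rewrite (big_nth 0) size_map size_walk (perm_size ps) size_coords//.
move=> _ /mapP[x xw ->]; have [mk|mk] := leqP m k; first exact: leq_trans mk.
have := bz (Ordinal mk); rewrite /= ltnn => /eqP zk.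
have /(@lam0 x (Ordinal mk)) // : x (Ordinal mk) = 0%R.
by rewrite (@walk_notin z s)// (perm_mem ps) mem_coords ltnn.
Qed.

(* The facet opposite to an inner vertex is shared by exactly two simplices. *)
Lemma inner_doors k j z : k <= m -> j.+1 < k ->
  \big[addb/false]_(s <- permutations (coords k)) door k j.+1 z s = false.
Proof.
move=> km jk; have szp s : s \in permutations (coords k) -> j.+1 < size s.
  by rewrite mem_permutations => /perm_size->; rewrite size_coords.
(* Partners differ by exchanging the steps before and after vertex [j.+1]; the order of these two
   steps tells them apart. *)
apply: (@xor_involution _ _ (swap_at j)
         (fun s => nth 0 (map val s) j < nth 0 (map val s) j.+1)).
- exact: permutations_uniq.
- exact: swap_atK.
- move=> s; rewrite !mem_permutations; exact/perm_trans/perm_swap_at.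
- move=> s sp; have js := szp _ sp.
  have m0 : 0 < m by exact: leq_trans (leq_trans _ jk) km.
  pose o := Ordinal m0.
  rewrite !(nth_map o) ?(perm_size (perm_swap_at _ _))// ?(ltnW js)//.
  have [-> ->] := nth_swap_at o js.
  have /negbTE : nth o s j != nth o s j.+1.
    rewrite nth_uniq ?(ltnW js) ?neq_ltn ?ltnSn//.
    by move: sp; rewrite mem_permutations => /perm_uniq->; exact: uniq_coords.
  by rewrite -(inj_eq val_inj) /=; case: ltngtP.
- move=> s /szp js; rewrite /door.
  have [l1 [l2 [x [y [-> -> sl]]]]] := walk_swap_at z js.
  rewrite !map_cat /= !nth_cat size_map sl ltnn subnn /=.
  by rewrite !(perm_catCA _ [:: _]) /= !perm_cons.
Qed.

(* The facet opposite to the first vertex of a simplex with base z and first step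
   i is the facet opposite to the last vertex of another one, based at
   [incr z i]; such facets cancel except on the boundary. *)
Lemma telescope k i (g : pred point) : i < k ->
  (forall x, x i = (-1)%R -> g x = false) ->
  \big[addb/false]_(z | base k z) g (incr z i) (+)
  \big[addb/false]_(z | base k z) g z =
  \big[addb/false]_(z | base k z && (z i == 0%R)) g z.
Proof.
move=> ik gN.
pose decr x : point := [ffun j => if j == i then (x j - 1)%R else x j].
have incrK : cancel (incr^~ i) decr.
  by move=> x; apply/ffunP => j; rewrite !ffunE; case: eqP; rewrite ?addrK.
have decrK : cancel decr (incr^~ i).
  by move=> x; apply/ffunP => j; rewrite !ffunE; case: eqP; rewrite ?subrK.
pose base' x := [forall j, (j != i) ==> if j < k then x j != (-1)%R else x j == 0%R].
have baseE x : base k x = base' x && (x i != (-1)%R).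
  apply/forallP/andP => [bx|[/forallP bx xi] j].
    by split; [apply/forallP => j; rewrite bx implybT|have := bx i; rewrite ik].
  by have := bx j; case: eqP => //= ->; rewrite ik.
have base'E x : base' (decr x) = base' x.
  by apply: eq_forallb => j; rewrite ffunE; case: eqP.
rewrite (reindex_onto decr (incr^~ i)) /=; last by move=> x _; exact: incrK.
(* For [x = incr z i], the condition [z i != -1] becomes [x i != 0]. *)
rewrite (eq_bigl (fun x => base' x && (x i != 0%R))); last first.
  move=> x; rewrite decrK eqxx andbT baseE base'E ffunE eqxx.
  by rewrite -(inj_eq (addIr 1%R)) subrK addNr.
rewrite (eq_bigr g) => [|x _]; last by rewrite decrK.
(* Terms with [x i = -1] vanish by [gN]; those with [x i] neither 0 nor -1 occur in both sums and
   cancel. *)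
rewrite (bigID (fun x => x i == (-1)%R)) /= big1 => [|x /andP[_ /eqP/gN//]].
rewrite [X in _ (+) X](bigID (fun x => x i == 0%R)) /= addbA addbAC.
rewrite [X in _ (+) X](_ : _ = \big[addb/false]_(x | base k x && (x i == 0%R)) g x) //.
rewrite (eq_bigl (fun x => base k x && (x i != 0%R))) ?addbb// => x.
by rewrite baseE -!andbA; congr (_ && _); rewrite andbC.
Qed.

(** Full simplices are counted by their doors. Inner doors cancel, the first and last ones telescope
    to the facets [z i = 0], and of these only the one for the last coordinate, which is the face of
    one dimension less, can carry the label [k]. *)
Lemma parityS k : k < m -> parity k.+1 = parity k.
Proof.
move=> km; pose o := Ordinal km.
rewrite /parity.
under eq_bigr => z bz do under eq_big_seq => s sp do rewrite (full_doors km bz sp).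
under eq_bigr => z bz do rewrite exchange_big big_nat_recl// big_nat_recr//=.
rewrite (eq_bigr (fun z =>
   \big[addb/false]_(s <- permutations (coords k.+1)) door k.+1 0 z s (+)
   \big[addb/false]_(s <- permutations (coords k.+1)) door k.+1 k.+1 z s)); last first.
  move=> z bz; congr (_ (+) _); rewrite -[RHS]addFb; congr (_ (+) _).
  by rewrite big_nat big1// => j /andP[_ jk]; exact: inner_doors.
pose g s z := perm_eq (labels z (behead s)) (iota 0 k.+1).
have szp s : s \in permutations (coords k.+1) -> s = head o s :: behead s.
  rewrite mem_permutations => /perm_size; rewrite size_coords//.
  by case: s.
(* Moving the first step to the end lets first-vertex and last-vertex facets be compared for the
   same tail. *)
have rotp : perm_eq (permutations (coords k.+1))
                    (map (rot 1) (permutations (coords k.+1))).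
  apply: uniq_perm; rewrite ?(map_inj_uniq (@rot_inj 1 _)) ?permutations_uniq// => s.
  apply/idP/mapP => [sp|[t tp ->]].
    exists (rotr 1 s); rewrite ?rotrK// mem_permutations perm_rotr.
    by rewrite -mem_permutations.
  by rewrite mem_permutations perm_rot -mem_permutations.
rewrite (eq_bigr (fun z =>
   \big[addb/false]_(s <- permutations (coords k.+1)) g s (incr z (head o s)) (+)
   \big[addb/false]_(s <- permutations (coords k.+1)) g s z)); last first.
  move=> z _; congr (_ (+) _); last rewrite (perm_big _ rotp) big_map.
    apply: eq_big_seq => s /szp ->; rewrite /door /g /=.
    by rewrite perm_cons.
  apply: eq_big_seq => s sp; rewrite (szp _ sp) rot1_cons /door /g /=.
  have [y ->] := walk_rcons z (behead s) (head o s).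
  have sz : size (behead s) = k.
    move: (sp); rewrite mem_permutations => /perm_size; rewrite size_coords//.
    by rewrite (szp _ sp) => -[].
  by rewrite map_rcons nth_rcons size_map size_walk sz ltnn eqxx perm_rcons perm_cons.
rewrite big_split /= exchange_big [X in _ (+) X]exchange_big -big_split /=.
rewrite (eq_big_seq (fun s =>
    \big[addb/false]_(z | base k.+1 z && (z (head o s) == 0%R)) g s z)); last first.
  move=> s sp; move: (sp); rewrite {1}(szp _ sp) => /coords_cons[hs hN].
  apply: (telescope hs) => x xN; apply/negP => /perm_mem/(_ (val (head o s))).
  rewrite mem_iota add0n leq0n hs => /mapP[y yw ye].
  have := lamN (x := y) (i := head o s); rewrite (walk_notin hN yw) => /(_ xN).
  by rewrite -ye eqxx.
(* By [lam0], the label [k] is missing on the facet of any coordinate below [k]. *)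
rewrite (bigID (fun s => head o s == o)) /= [X in _ (+) X]big1_seq ?addbF; last first.
  move=> s /andP[ho sp]; rewrite big1// => z /andP[_ /eqP zi].
  move: (sp); rewrite (szp _ sp) => /coords_cons[]; rewrite ltnS leq_eqVlt => hs hN.
  have {}hs : head o s < k by case/orP: hs => // /eqP ek; case/eqP: ho; exact: val_inj.
  apply/negP => /perm_mem/(_ k); rewrite mem_iota add0n leq0n ltnSn => /mapP[y yw ye].
  have := lam0 (x := y) (i := head o s); rewrite (walk_notin hN yw) => /(_ zi).
  by rewrite -ye leqNgt hs.
have cS : perm_eq (o :: coords k) (coords k.+1).
  apply: uniq_perm; rewrite /= ?uniq_coords ?mem_coords ?ltnn// => i.
  by rewrite inE -val_eqE !mem_coords ltnS [RHS]leq_eqVlt.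
rewrite -big_filter.
have fp : perm_eq [seq s <- permutations (coords k.+1) | head o s == o]
                  (map (cons o) (permutations (coords k))).
  apply: uniq_perm; first by rewrite filter_uniq ?permutations_uniq.
    by rewrite map_inj_uniq ?permutations_uniq// => s t [].
  move=> s; rewrite mem_filter; apply/andP/mapP => [[/eqP ho sp]|[t tp ->]].
    exists (behead s); last by rewrite {1}(szp _ sp) ho.
    rewrite mem_permutations -(perm_cons o) -{1}ho -szp// (permPr cS).
    by rewrite -mem_permutations.
  by rewrite /= eqxx mem_permutations -(permPr cS) perm_cons -mem_permutations.
rewrite (perm_big _ fp) big_map /= exchange_big /=.
apply: eq_bigl => z; apply/andP/forallP => [[/forallP bz /eqP zo] i|bz].
  have := bz i; rewrite ltnS; case: ltngtP => // ik _.
  have -> : i = o by exact: val_inj.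
  by rewrite zo.
have zo : z o == 0%R by have := bz o; rewrite ltnn.
split=> //; apply/forallP => i; have := bz i; rewrite ltnS.
case: ltngtP => // ik _; have -> : i = o by exact: val_inj.
by rewrite (eqP zo) eq_sym oppr_eq0 oner_eq0.
Qed.

(** The face of dimension 0 is the origin alone, whose label is 0. *)
Lemma parity_true k : k <= m -> parity k.
Proof.
elim: k => [|k IH] km; last by rewrite parityS// IH// ltnW.
have c0 : coords 0 = [::] by apply/eqP; rewrite -size_eq0 size_coords.
rewrite /parity (big_pred1 [ffun=> 0%R]) => [|z]; last first.
  apply/forallP/eqP => [bz|-> i]; last by rewrite ffunE.
  by apply/ffunP => i; rewrite ffunE; apply/eqP; exact: bz.
rewrite c0 big_seq1 /full /= perm_sym.
have -> : lam [ffun=> 0%R] = 0; last by [].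
have [m0|m0] := posnP m.
  by apply/eqP; rewrite -leqn0 -[X in _ <= X]m0.
by apply/eqP; rewrite -leqn0 (lam0 (i := Ordinal m0))// ffunE.
Qed.

Lemma cubical_sperner : exists z : point, (forall i, z i != (-1)%R) /\
  forall p, p <= m -> exists2 x, lam x = p & forall i, x i = z i \/ x i = (z i + 1)%R.
Proof.
have : parity m by exact: parity_true.
have [|no] := boolP [exists z, base m z &&
    has (full m z) (permutations (coords m))].
  case/existsP => z /andP[/forallP bz /hasP[s]].
  rewrite mem_permutations => sp fs _; exists z; split=> [i|p pm].
    by have := bz i; rewrite ltn_ord.
  have : p \in labels z s by rewrite (perm_mem fs) mem_iota.
  case/mapP => x xw ->; exists x => // i; apply: walk_step xw.
  by rewrite (perm_uniq sp) uniq_coords.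
rewrite /parity big1 => // z bz; rewrite big1_seq// => s /andP[_ sp].
apply/negbTE; apply: contra no => fs; apply/existsP; exists z; rewrite bz.
by apply/hasP; exists s.
Qed.
End Sperner.

(** * Lebesgue's covering theorem on the grid *)

(** Here [kap x] stands for the member chosen around [x] and [col] for its family. *)
Lemma lebesgue_grid (m N : nat) (T : Type)
    (kap : {ffun 'I_m -> 'I_N.+2} -> T) (col : T -> 'I_m) :
  (forall x y : {ffun 'I_m -> 'I_N.+2},
     (forall i, x i <= (y i).+1 /\ y i <= (x i).+1) ->
     col (kap x) = col (kap y) -> kap x = kap y) ->
  exists x y i, [/\ kap x = kap y, x i = ord0 & y i = ord_max].
Proof.
move=> kapP; apply: contrapT => no.
have oppr1 : (-1)%R = ord_max :> 'I_N.+2.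
  by apply: val_inj; rewrite /= !modn_small// subn1.
pose full_at (x : {ffun 'I_m -> 'I_N.+2}) j :=
  `[< exists y (i : 'I_m), [/\ kap y = kap x, val i = j & y i = ord_max] >].
pose lam (x : {ffun 'I_m -> 'I_N.+2}) := find (predC (full_at x)) (iota 0 m).
have lam_max x : lam x <= m by rewrite -[m in X in _ <= X](size_iota 0) find_size.
have lam0 (x : {ffun 'I_m -> 'I_N.+2}) i : x i = 0%R -> lam x <= i.
  move=> xi; rewrite leqNgt; apply/negP => /(before_find 0)/=.
  rewrite nth_iota ?add0n// => /negbFE/asboolP[y [j [yx /val_inj ji yN]]].
  by apply: no; exists x, y, i; rewrite -{2}ji.
have lamN (x : {ffun 'I_m -> 'I_N.+2}) i : x i = (-1)%R -> lam x != i.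
  move=> xi; apply/negP => /eqP li.
  have : has (predC (full_at x)) (iota 0 m) by rewrite has_find -/(lam x) li size_iota.
  move/(nth_find 0); rewrite -/(lam x) li /= nth_iota// add0n => /asboolP; apply.
  by exists x, i; rewrite xi oppr1.
have [z [zN zP]] := cubical_sperner lam_max lam0 lamN.
(* There is no wrap-around, since [z i] is not the last coordinate. *)
have valD i : (z i + 1)%R = (z i).+1 :> nat.
  rewrite /= [1 %% _]modn_small// modn_small addn1// ltnS ltn_neqAle -ltnS ltn_ord andbT.
  by have := zN i; rewrite oppr1 -val_eqE.
have /choice[xs xsP] (p : 'I_m.+1) : exists x, lam x = p /\
    forall i, z i <= x i <= (z i).+1.
  have [|x xp xz] := zP p; first by rewrite -ltnS.
  exists x; split=> // i; have [->|->] := xz i; first by rewrite leqnn leqnSn.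
  by rewrite valD leqnn leqnSn.
(* There are m + 1 labelled vertices but only m families. *)
have : ~~ injectiveb (fun p => col (kap (xs p))).
  by apply/negP => /injectiveP/leq_card; rewrite !card_ord ltnn.
case/injectivePn => p [q pq cpq]; case/eqP: pq; apply: val_inj => /=.
have [<- hp] := xsP p; have [<- hq] := xsP q.
suff E : kap (xs p) = kap (xs q) by rewrite /lam /full_at E.
apply: kapP cpq => i; have /andP[p1 p2] := hp i; have /andP[q1 q2] := hq i.
by split; [exact: leq_trans p2 _ | exact: leq_trans q2 _].
Qed.

Local Open Scope classical_set_scope.
Local Open Scope ring_scope.

(** * Grids of persistence diagrams *)

Section Diagrams.
Variable R : realType.
Implicit Types (mu nu : diagram R).

(** * Diagrams given by tuples, and bounds on their distance *)

Lemma tuple_mult_finite (k : nat) (t : k.-tuple (hatX R)) :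
  finite_set [set p | #|[pred i | tnth t i == p]| != 0%N].
Proof.
apply: (@sub_finite_set _ _ [set` val t]); last exact: finite_seq.
by move=> p /=; rewrite -lt0n => /card_gt0P[i]; rewrite inE => /eqP<-; exact: mem_tnth.
Qed.

Lemma tuple_mult_diagonal (k : nat) (t : k.-tuple (hatX R)) :
  (forall i, ~~ Defs.diagonal (tnth t i)) ->
  forall p, Defs.diagonal p -> #|[pred i | tnth t i == p]| = 0%N.
Proof.
move=> nd p dp; apply: eq_card0 => i; rewrite !inE; apply/negP => /eqP E.
by have := nd i; rewrite E dp.
Qed.

Definition tuple_diagram (k : nat) (t : k.-tuple (hatX R))
    (nd : forall i, ~~ Defs.diagonal (tnth t i)) : diagram R :=
  Diagram (tuple_mult_finite t) (tuple_mult_diagonal nd).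

Lemma supp_tuple_diagram k (t : k.-tuple (hatX R)) nd p :
  supp (tuple_diagram (t := t) nd) p <-> exists i, p = tnth t i.
Proof.
rewrite /supp /=; split=> [/card_gt0P[i]|[i ->]].
  by rewrite inE => /eqP<-; exists i.
by apply/card_gt0P; exists i; rewrite inE.
Qed.

Lemma seq_repr_tuple_diagram k (t : k.-tuple (hatX R)) nd :
  seq_repr (tuple_diagram (t := t) nd) t.
Proof. by split=> // i []; apply/supp_tuple_diagram; exists i. Qed.

Lemma le_perm_cost k (a b : k.-tuple (hatX R)) (s : 'S_k) i :
  rho (tnth a i) (tnth b (s i)) <= perm_cost a b s.
Proof. by rewrite /perm_cost (bigD1 i)//= le_max lexx. Qed.

Lemma perm_cost_ge0 k (a b : k.-tuple (hatX R)) (s : 'S_k) : 0 <= perm_cost a b s.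
Proof.
rewrite /perm_cost; elim/big_ind: _ => // [x y x0 y0|i _]; first by rewrite le_max x0.
by rewrite /rho le_max normr_ge0.
Qed.

Lemma le_matching_cost k (a b : k.-tuple (hatX R)) (c : R) :
  (forall s, c <= perm_cost a b s) -> c <= matching_cost a b.
Proof.
move=> h; rewrite /matching_cost; elim/big_ind: _ => // x y cx cy.
by rewrite le_min cx.
Qed.

Lemma bottleneck_tuple_diagram_le k (t u : k.-tuple (hatX R)) ndt ndu (c : R) : 0 <= c ->
  (forall i, rho (tnth t i) (tnth u i) <= c) ->
  bottleneck (tuple_diagram (t := t) ndt) (tuple_diagram (t := u) ndu) <= c.
Proof.
move=> c0 h; apply: (@le_trans _ _ (matching_cost t u)).
  apply: ge_inf.
    exists 0 => _ [l [a [b [_ _ ->]]]]; apply: le_matching_cost => s.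
    exact: perm_cost_ge0.
  by exists k, t, u; split=> //; exact: seq_repr_tuple_diagram.
rewrite /matching_cost (bigD1 1%g)//= ge_min; apply/orP; left.
rewrite /perm_cost; elim/big_ind: _ => // [x y xc yc|i _]; first by rewrite ge_max xc.
by rewrite perm1.
Qed.

(** Every matching sends [p] to a support point of [nu] or to the diagonal. The common length of
    representations makes the set of costs nonempty, as [lb_le_inf] requires. *)
Lemma bottleneck_ge mu nu (p : hatX R) (c : R) : supp mu p ->
  (exists k (a b : k.-tuple (hatX R)), seq_repr mu a /\ seq_repr nu b) ->
  (forall q, supp nu q \/ Defs.diagonal q -> c <= rho p q) -> c <= bottleneck mu nu.
Proof.
move=> sp [k [a [b [ra rb]]]] h; apply: lb_le_inf.
  by exists (matching_cost a b), k, a, b.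
move=> _ [l [a' [b' [[ra1 _] [_ rb2] ->]]]]; apply: le_matching_cost => s.
have : (0 < #|[pred i | tnth a' i == p]|)%N by rewrite ra1.
case/card_gt0P => i; rewrite inE => /eqP ip.
apply: le_trans (le_perm_cost a' b' s i); rewrite ip; apply: h.
by have [|/rb2] := pselect (supp nu (tnth b' (s i))); [left|right].
Qed.

Definition grid_point (N i x : nat) : R * R := ((N * i)%:R, (N * i + N * 2 + x)%:R).

Lemma grid_point_ge0 N i x : 0 <= (grid_point N i x).1 <= (grid_point N i x).2.
Proof. by rewrite /= ler0n ler_nat -addnA leq_addr. Qed.

Definition grid_hatX N i x : hatX R :=
  exist (fun p : R * R => is_true (0 <= p.1 <= p.2)) _ (grid_point_ge0 N i x).

Lemma rho_grid_hatX N i x y :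
  rho (grid_hatX N i x) (grid_hatX N i y) = `|x%:R - y%:R|.
Proof.
rewrite /rho /= subrr normr0 !(natrD _ (_ + _)).
by rewrite opprD addrACA subrr add0r max_r.
Qed.

Variables (m N : nat).
Local Notation point := {ffun 'I_m -> 'I_N.+2}.

Definition grid_tuple (x : point) : m.-tuple (hatX R) :=
  [tuple grid_hatX N.+1 i (x i) | i < m].

Lemma grid_tuple_off_diagonal x i : ~~ Defs.diagonal (tnth (grid_tuple x) i).
Proof.
rewrite tnth_mktuple /Defs.diagonal /= eqr_nat -addnA -[X in X == _]addn0 eqn_add2l.
by rewrite eq_sym.
Qed.

Definition grid_diagram (x : point) : diagram R :=
  tuple_diagram (grid_tuple_off_diagonal x).

Lemma bottleneck_grid_le1 (x y : point) :
  (forall i, x i <= (y i).+1 /\ y i <= (x i).+1)%N ->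
  bottleneck (grid_diagram x) (grid_diagram y) <= 1.
Proof.
move=> xy; apply: bottleneck_tuple_diagram_le => // i.
rewrite !tnth_mktuple rho_grid_hatX; have [] := xy i.
rewrite -!(ler_nat R) -!natr1 => h1 h2.
by rewrite ler_norml; apply/andP; split; lra.
Qed.

Lemma bottleneck_grid_ge (x y : point) i : x i = ord0 -> y i = ord_max ->
  N.+1%:R <= bottleneck (grid_diagram x) (grid_diagram y).
Proof.
move=> xi yi; apply: (bottleneck_ge (p := grid_hatX N.+1 i 0)).
- by apply/supp_tuple_diagram; exists i; rewrite tnth_mktuple xi.
- by exists m, (grid_tuple x), (grid_tuple y); split; exact: seq_repr_tuple_diagram.
move=> q [/supp_tuple_diagram[j ->]|/eqP qd]; last first.
  (* A diagonal point [(t, t)] cannot be within less than [N.+1] of both coordinates, which are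
     [2 * N.+1] apart. *)
  rewrite /rho /= -qd leNgt; apply/negP; rewrite gt_max !ltr_norml.
  rewrite addn0 natrD !natrM => /andP[/andP[+ _] /andP[_ +]].
  by set t := (sval q).1; set a := _ * i%:R; clear; lra.
rewrite tnth_mktuple; have [->|ij] := eqVneq j i.
  by rewrite yi rho_grid_hatX sub0r normrN ger0_norm.
(* Points of different indices already differ by at least [N.+1] in the first coordinate. *)
rewrite /rho /= le_max; apply/orP; left.
rewrite !natrM -mulrBr normrM ger0_norm// ler_peMr//.
move: ij; rewrite -val_eqE /= neq_ltn => /orP[] ij.
  by rewrite ger0_norm ?subr_ge0 ?ler_nat ?(ltnW ij)// -natrB ?ler1n ?subn_gt0// ltnW.
rewrite distrC ger0_norm ?subr_ge0 ?ler_nat ?(ltnW ij)//.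
by rewrite -natrB ?ler1n ?subn_gt0// ltnW.
Qed.

End Diagrams.

(** * Infinite asymptotic dimension *)

Theorem theorem3p2 (R : realType) :
  ~ exists n : nat, asdim_le (diagram R) n.
Proof.
(* The scale 2 exceeds the bound 1 on the distance of neighbouring grid diagrams. *)
move=> [n /(_ 2 (ltr0n _ 2))[U [V [Ub Ucov UV Vdisj]]]].
have [B BP] : exists B : R, forall A mu nu, U A -> A mu -> A nu -> bottleneck mu nu <= B.
  have leB A mu nu : U A -> A mu -> A nu ->
      ((bottleneck mu nu)%:E <= ereal_sup [set diam A | A in U])%E.
    move=> UA Amu Anu; apply: (@le_trans _ _ (diam A)).
      by apply: ereal_sup_ubound; exists (mu, nu).
    by apply: ereal_sup_ubound; exists A.
  move: Ub leB; rewrite /uniformly_bounded; case: ereal_sup => [B| |] // _ leB.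
    by exists B => A mu nu UA Amu Anu; rewrite -lee_fin; exact: leB UA Amu Anu.
  (* Here the supremum is [-oo], so no member contains a diagram. *)
  by exists 0 => A mu nu UA Amu Anu; have := leB _ _ _ UA Amu Anu.
pose N := Num.bound `|B|.
(* A member may lie in several families, so the index of one of them is recorded with it. *)
have /choice[kap kapP] (x : {ffun 'I_n.+1 -> 'I_N.+2}) :
    exists c : 'I_n.+1 * set (diagram R), V c.1 c.2 /\ c.2 (grid_diagram R x).
  have : [set: diagram R] (grid_diagram R x) by [].
  by rewrite -Ucov => -[A]; rewrite {1}UV => -[i _ VA] Ax; exists (i, A).
have [|x [y [i [kxy xi yi]]]] := lebesgue_grid (kap := kap) (col := fst).
  move=> x y /bottleneck_grid_le1-/(_ R) xy cxy.
  have [Vx Ax] := kapP x; have [Vy Ay] := kapP y.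
  rewrite [kap x]surjective_pairing [kap y]surjective_pairing cxy; congr pair.
  (* Distinct members of one family would be at distance at least 2, yet they contain diagrams at
     distance at most 1. *)
  apply: contrapT => nxy; rewrite cxy in Vx.
  have := Vdisj _ _ _ Vx Vy nxy; apply/negP; rewrite -ltNge.
  apply: (@le_lt_trans _ _ (bottleneck (grid_diagram R x) (grid_diagram R y))%:E).
    by apply: ereal_inf_lbound; exists (grid_diagram R x, grid_diagram R y).
  by rewrite lte_fin; apply: le_lt_trans xy _; rewrite ltr1n.
have [Vx Ax] := kapP x; have [_ Ay] := kapP y; rewrite -kxy in Ay.
have UA : U (kap x).2 by rewrite UV; exists (kap x).1.
have := le_trans (bottleneck_grid_ge R xi yi) (BP _ _ _ UA Ax Ay).
apply/negP; rewrite -ltNge; apply: le_lt_trans (ler_norm _) _.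
apply: lt_trans (archi_boundP (normr_ge0 B)) _.
by rewrite ltr_nat.
Qed.
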